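(* For every regular uncountable cardinal $\kappa$, $\mathfrak{s}_\kappa \leq \mathfrak{b}_\kappa$.
   Context: Let $\kappa>\omega$ be regular. For $f,g\in\kappa^\kappa$, $f<^{\ast}g$ means $|\{\alpha<\kappa: g(\alpha)\le f(\alpha)\}|<\kappa$. A set $F\subset\kappa^\kappa$ is unbounded if there is no $g\in\kappa^\kappa$ with $f<^\ast g$ for all $f\in F$; $\mathfrak{b}_\kappa$ is the least cardinality of an unbounded family. For $a,b\subset\kappa$, $a$ splits $b$ if both $b\cap a$ and $b\setminus a$ have cardinality $\kappa$; $F\subset\mathcal{P}(\kappa)$ is a splitting family if every $b\in[\kappa]^\kappa$ is split by some $a\in F$; $\mathfrak{s}_\kappa$ is the least cardinality of a splitting family. *)

(* Defs.v *)
From mathcomp Require Import all_boot all_order.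
From mathcomp Require Import all_classical.

Set Implicit Arguments.
Unset Strict Implicit.
Unset Printing Implicit Defensive.

Local Open Scope classical_set_scope.
Local Open Scope card_scope.
Local Open Scope order_scope.

(* |A| < |B| *)
Definition card_lt (T U : Type) (A : set T) (B : set U) : Prop :=
  A #<= B /\ ~ (A #= B).

(* C is cofinal in K *)
Definition cofinal (d : Order.disp_t) (K : orderType d) (C : set K) : Prop :=
  forall x, exists2 y, C y & x <= y.

(* A cardinal kappa is represented, as usual, by an initial ordinal: a
   well-ordered type K all of whose proper initial segments have cardinality
   smaller than that of K.  It is regular when its cofinality is kappa, that
   is, when each of its cofinal subsets has cardinality kappa. *)
Record regular_uncountable (d : Order.disp_t) (K : orderType d) : Prop := {
  ru_wf : well_founded (fun x y : K => x < y);
  ru_initial : forall x : K, card_lt [set y : K | y < x] [set: K];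
  ru_uncountable : ~ countable [set: K];
  ru_regular : forall C : set K, cofinal C -> C #= [set: K]
}.

(* f <* g *)
Definition lt_star (d : Order.disp_t) (K : orderType d) (f g : K -> K) : Prop :=
  card_lt [set x | g x <= f x] [set: K].

Definition unbounded_family (d : Order.disp_t) (K : orderType d)
    (F : set (K -> K)) : Prop :=
  ~ exists g : K -> K, forall f, F f -> lt_star f g.

(* a splits b *)
Definition splits (K : Type) (a b : set K) : Prop :=
  (b `&` a) #= [set: K] /\ (b `\` a) #= [set: K].

Definition splitting_family (K : Type) (F : set (set K)) : Prop :=
  forall b : set K, b #= [set: K] -> exists2 a, F a & splits a b.

Definition least_cardinality (T : Type) (P : set (set T)) (F : set T) : Prop :=
  P F /\ forall G, P G -> F #<= G.

(* The least cardinality of a member of P, represented by a chosen member of P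
   of least cardinality; such a member exists by [min_cardP] below, and
   cardinals are compared by [_ #<= _].  The value when P is empty is junk. *)
Definition min_card (T : Type) (P : set (set T)) : set T :=
  xget set0 (least_cardinality P).

(* b_kappa *)
Definition bounding_number (d : Order.disp_t) (K : orderType d) :
    set (K -> K) :=
  min_card (@unbounded_family d K).

(* s_kappa *)
Definition splitting_number (K : Type) : set (set K) :=
  min_card (@splitting_family K).

Arguments bounding_number {d} K _.
Arguments splitting_number K _ : clear implicits.

Import Order.TTheory.

Lemma ex_least_cardinality (T : Type) (P : set (set T)) :
  P !=set0 -> exists F, least_cardinality P F.
Proof.
move=> [F0 PF0].
pose ok (S : set ({G | P G} -> T)) :=
  (forall f, S f -> forall G, sval G (f G)) /\
  (forall f g, S f -> S g -> forall G, f G = g G -> f = g).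
have [|S [okS maxS]] := @Zorn_bigcup _ ok.
  move=> C Cok tot; split.
    by move=> f [X CX Xf] G; apply: (Cok _ CX).1.
  move=> f g [X CX Xf] [Y CY Yg] G.
  have [XY|YX] := tot _ _ CX CY.
    by apply: (Cok _ CY).2 => //; apply: XY.
  by apply: (Cok _ CX).2 => //; apply: YX.
case: okS => memS injS.
have [G Gsurj] : exists G : {G | P G},
    forall y, sval G y -> exists2 f, S f & f G = y.
  apply: contrapT => noG.
  have /choice [f0 f0P] : forall G : {G | P G}, exists y,
      sval G y /\ forall f, S f -> f G <> y.
    move=> G; apply: contrapT => noy; apply: noG; exists G => y Gy.
    apply: contrapT => nof; apply: noy; exists y; split=> // f Sf fG.
    by apply: nof; exists f.
  have nSf0 : ~ S f0.
    by move=> Sf0; apply: ((f0P (exist _ F0 PF0)).2 f0 Sf0).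
  apply: (maxS (S `|` [set f0])).
    split; first by left.
    by move=> /(_ f0 (or_intror erefl)).
  split.
    by move=> f [/memS//|->] G; exact: (f0P G).1.
  move=> f g [Sf|->] [Sg|->] H e //.
  - exact: injS e.
  - by have := (f0P H).2 _ Sf e.
  - by have := (f0P H).2 _ Sg (esym e).
exists (sval G); split; first exact: (svalP G).
move=> H PH; pose H' : {G | P G} := exist _ H PH.
apply: (@card_le_trans _ _ _ S).
  apply: card_le_trans (card_image_le (fun f => f G) S).
  by apply: subset_card_le => y /Gsurj[f Sf fy]; exists f.
have /card_eqPle[_ leS] : (fun f => f H') @` S #= S.
  by apply: inj_card_eq => f g /set_mem Sf /set_mem Sg; exact: injS.
apply: card_le_trans leS _.
by apply: subset_card_le => _ [f Sf <-]; exact: (memS f Sf H').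
Qed.

Lemma min_cardP (T : Type) (P : set (set T)) :
  P !=set0 -> least_cardinality P (min_card P).
Proof. by move=> /ex_least_cardinality; exact: xgetPex. Qed.

Lemma bounding_numberP (d : Order.disp_t) (K : orderType d) :
  least_cardinality (@unbounded_family d K) (bounding_number K).
Proof.
apply: min_cardP; exists setT => -[g /(_ g I)[_]]; apply.
by rewrite (_ : [set _ | _] = setT)//; apply/seteqP; split => x _ /=.
Qed.

Lemma bounded_of_small (d : Order.disp_t) (K : orderType d) (A : set K) :
  regular_uncountable K -> ~ (A #= [set: K]) -> exists x, forall y, A y -> y < x.
Proof.
move=> Kreg nA; apply: contrapT => nbd; apply: nA; apply: (ru_regular Kreg) => x.
apply: contrapT => nox; apply: nbd; exists x => y Ay.
by rewrite ltNge; apply/negP => xy; apply: nox; exists y.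
Qed.

Lemma splitting_family_setT (d : Order.disp_t) (K : orderType d) :
  regular_uncountable K -> splitting_family [set: set K].
Proof.
move=> Kreg b bK.
(* a maximal injective partial pairing between disjoint subsets of b *)
pose ok (S : set (K * K)) :=
  (forall p, S p -> [/\ b p.1, b p.2 & p.1 <> p.2]) /\
  (forall p q, S p -> S q -> [\/ p.1 = q.1, p.1 = q.2, p.2 = q.1 | p.2 = q.2] ->
     p = q).
have [|S [[memS injS] maxS]] := @Zorn_bigcup _ ok.
  move=> C Cok tot; split.
    by move=> p [X CX Xp]; apply: (Cok _ CX).1.
  move=> p q [X CX Xp] [Y CY Yq].
  have [XY|YX] := tot _ _ CX CY.
    by apply: (Cok _ CY).2 => //; apply: XY.
  by apply: (Cok _ CX).2 => //; apply: YX.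
pose a1 := fst @` S; pose a2 := snd @` S.
have a1S : a1 #= S.
  apply: inj_card_eq => p q /set_mem Sp /set_mem Sq e.
  by apply: injS => //; constructor 1.
have a2S : a2 #= S.
  apply: inj_card_eq => p q /set_mem Sp /set_mem Sq e.
  by apply: injS => //; constructor 4.
have rest x y : b x -> b y -> ~ a1 x -> ~ a2 x -> ~ a1 y -> ~ a2 y -> x = y.
  move=> bx by_ a1x a2x a1y a2y; apply: contrapT => xy.
  apply: (maxS (S `|` [set (x, y)])).
    split; first by left.
    by move=> /(_ (x, y) (or_intror erefl)) Sxy; apply: a1x; exists (x, y).
  split; first by move=> p [/memS//|->].
  move=> p q [Sp|->] [Sq|->] //=.
  - exact: injS.
  - by case=> e; exfalso; [apply: a1x|apply: a1y|apply: a2x|apply: a2y]; exists p.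
  - by case=> e; exfalso; [apply: a1x|apply: a2x|apply: a1y|apply: a2y]; exists q.
have a1b : a1 `<=` b by move=> _ [p /memS[? _ _] <-].
have a2b : a2 `<=` b `\` a1.
  move=> _ [p Sp <-]; split; first by have [] := memS _ Sp.
  move=> [q Sq e]; have pq : q = p by apply: injS => //; constructor 2.
  by have [_ _] := memS _ Sp; apply; rewrite -{1}pq.
have a1K : a1 #= [set: K].
  apply: contrapT => na1.
  have na2 : ~ (a2 #= [set: K]).
    by move=> a2K; apply: na1; apply: card_eq_trans a2K;
      apply: card_eq_trans a1S _; rewrite card_eq_sym.
  have [x1 lt1] := bounded_of_small Kreg na1.
  have [x2 lt2] := bounded_of_small Kreg na2.
  have [x bx] : exists x, forall y, b y -> y <= x.
    have [[z [bz z1 z2]]|noz] := pselect (exists z, [/\ b z, ~ a1 z & ~ a2 z]).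
      exists (Order.max z (Order.max x1 x2)) => y By; rewrite !le_max.
      have [/lt1/ltW->|y1] := pselect (a1 y); first by rewrite orbT.
      have [/lt2/ltW->|y2] := pselect (a2 y); first by rewrite !orbT.
      by rewrite (rest y z) // lexx.
    exists (Order.max x1 x2) => y By; rewrite le_max.
    have [/lt1/ltW->//|y1] := pselect (a1 y).
    have [/lt2/ltW->|y2] := pselect (a2 y); first by rewrite orbT.
    by exfalso; apply: noz; exists y.
  have nx : ~ ([set x] #= [set: K]).
    move=> xK; apply: (ru_uncountable Kreg).
    by rewrite /countable -(card_le_eql xK); apply: finite_set_countable.
  have [z /(_ x erefl) xz] := bounded_of_small Kreg nx.
  have [ltz neqz] := ru_initial Kreg z; apply: neqz.
  apply/card_eqPle; split => //; rewrite -(card_le_eql bK).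
  by apply: subset_card_le => y /bx yx /=; exact: le_lt_trans xz.
have a2K : a2 #= [set: K].
  by apply: card_eq_trans a1K; apply: card_eq_trans a2S _; rewrite card_eq_sym.
exists a1 => //; split.
  by rewrite setIC (setIidl a1b).
apply/card_eqPle; split; first exact: subset_card_le.
by move/card_eqPle: a2K => [_ /card_le_trans]; apply; exact: subset_card_le.
Qed.

Lemma splitting_numberP (d : Order.disp_t) (K : orderType d) :
  regular_uncountable K ->
  least_cardinality (@splitting_family K) (splitting_number K).
Proof.
by move=> Kreg; apply: min_cardP; exists setT; exact: splitting_family_setT.
Qed.

(* Main.v *)
(* Let F be an unbounded family of size b_kappa.  For h in F let G h y be the
   least x with y <= max(x, h x).  Finite compositions f of the maps G h,
   together with constants, define a family of |F| subsets of kappa.  Suppose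
   that it does not split some unbounded set A, so that modulo bounded sets A
   decides all these subsets.  Since decreasing sequences of functions modulo A
   are finite, there is a composition f that tends to kappa along A and is
   minimal as such under f |-> G h o f.  If G h o f < f on almost all of A, then
   by minimality G h o f is bounded by a constant x almost everywhere, so that f
   is bounded there by the supremum of h on [0, x], a contradiction.  Hence
   G h o f = f almost everywhere on A, that is, the values of f on a tail of A
   are closed under h, and picking a value of f above x on a late point of A
   gives a single function dominating F. *)
Require Import Defs.
From mathcomp Require Import all_boot all_order.
From mathcomp Require Import all_classical.

Local Open Scope card_scope.

Set Implicit Arguments.
Unset Strict Implicit.
Unset Printing Implicit Defensive.

Import Order.TTheory.
Local Open Scope order_scope.
Local Open Scope classical_set_scope.

(** * Comparing cardinals by injections *)

Lemma card_le_inj (T U : Type) (A : set T) (B : set U) (f : T -> U) :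
  (forall x, A x -> B (f x)) ->
  (forall x y, A x -> A y -> f x = f y -> x = y) -> A #<= B.
Proof.
move=> fB finj.
have /injfunPex[g] : exists2 g : T -> U, set_fun A B g & set_inj A g.
  by exists f => // x y /set_mem Ax /set_mem Ay; exact: finj.
exact: inj_card_le.
Qed.

Lemma card_le_injE (T U : Type) (A : set T) (B : set U) :
  A #<= B -> B !=set0 -> exists f : T -> U,
    (forall x, A x -> B (f x)) /\
    (forall x y, A x -> A y -> f x = f y -> x = y).
Proof.
move=> + [b0 _]; elim/Ppointed: U => U in B b0 *; first by have := no b0.
move=> /pcard_leP /injfunPex[f fB finj]; exists f; split=> // x y Ax Ay.
by apply: finj; exact: mem_set.
Qed.

(** A maximal partial injection, as a set of pairs, exhausts [A] or [B]: a point missed on each side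
    would give one more pair. *)
Lemma card_le_total (T U : Type) (A : set T) (B : set U) :
  A #<= B \/ B #<= A.
Proof.
pose ok (S : set (T * U)) :=
  (forall p, S p -> A p.1 /\ B p.2) /\
  (forall p q, S p -> S q -> p.1 = q.1 \/ p.2 = q.2 -> p = q).
have [|S [[memS injS] maxS]] := @Zorn_bigcup _ ok.
  move=> C Cok tot; split.
    by move=> p [X CX Xp]; apply: (Cok _ CX).1.
  move=> p q [X CX Xp] [Y CY Yq].
  have [XY|YX] := tot _ _ CX CY.
    by apply: (Cok _ CY).2 => //; apply: XY.
  by apply: (Cok _ CX).2 => //; apply: YX.
have S1 : fst @` S #= S.
  apply: inj_card_eq => p q /set_mem Sp /set_mem Sq e.
  by apply: injS => //; left.
have S2 : snd @` S #= S.
  apply: inj_card_eq => p q /set_mem Sp /set_mem Sq e.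
  by apply: injS => //; right.
have S12 : fst @` S #= snd @` S.
  by apply: card_eq_trans S1 _; rewrite card_eq_sym.
have [AS|nAS] := pselect (A `<=` fst @` S).
  left; apply: card_le_trans (subset_card_le AS) _.
  rewrite (card_le_eql S12); apply: subset_card_le => _ [p Sp <-].
  by have [] := memS p Sp.
have [BS|nBS] := pselect (B `<=` snd @` S).
  right; apply: card_le_trans (subset_card_le BS) _.
  rewrite -(card_le_eql S12); apply: subset_card_le => _ [p Sp <-].
  by have [] := memS p Sp.
move/nonsubset: nAS => [x [Ax nx]]; move/nonsubset: nBS => [y [By ny]].
exfalso; apply: (maxS (S `|` [set (x, y)])).
  split; first by left.
  by move=> /(_ (x, y) (or_intror erefl)) Sxy; apply: nx; exists (x, y).
split; first by move=> p [/memS//|->].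
move=> p q [Sp|->] [Sq|->] //=; first exact: injS.
- by case=> e; exfalso; [apply: nx|apply: ny]; exists p.
- by case=> e; exfalso; [apply: nx|apply: ny]; exists q.
Qed.

Lemma card_leX (T U V W : Type) (A : set T) (B : set U) (C : set V)
    (D : set W) : A #<= C -> B #<= D -> A `*` B #<= C `*` D.
Proof.
move=> AC BD.
have [C0|/set0P C0] := eqVneq C set0.
  by move: AC; rewrite C0 card_le0 => /eqP ->; rewrite set0X.
have [D0|/set0P D0] := eqVneq D set0.
  by move: BD; rewrite D0 card_le0 => /eqP ->; rewrite setX0.
have [f [fC finj]] := card_le_injE AC C0.
have [g [gD ginj]] := card_le_injE BD D0.
apply: (@card_le_inj _ _ _ _ (fun u => (f u.1, g u.2))).
  by move=> u [/fC ? /gD ?].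
by move=> [a b] [a' b'] [/= ? ?] [/= ? ?] [/finj-> // /ginj->].
Qed.

(** The tags [t0] and [t1] keep the images of [A] and of the rest of [B] apart inside the square of
    [C]. *)
Lemma card_setU_le_square (T U : Type) (A B : set T) (C : set U) :
  A #<= C -> B #<= C -> C `*` C #<= C ->
  (exists t0 t1, [/\ C t0, C t1 & t0 <> t1]) ->
  A `|` B #<= C.
Proof.
move=> AC BC CC [t0 [t1 [Ct0 Ct1 t01]]].
have C0 : C !=set0 by exists t0.
have [f [fC finj]] := card_le_injE AC C0.
have [g [gC ginj]] := card_le_injE BC C0.
apply: card_le_trans CC.
apply: (@card_le_inj _ _ _ _
  (fun x => if `[< A x >] then (f x, t0) else (g x, t1))).
  by move=> x; case: asboolP => [Ax _|nAx [//|Bx]]; split=> //=; auto.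
move=> x y; case: asboolP => [Ax _|nAx [//|Bx]];
  case: asboolP => [Ay _|nAy [//|By]] [] //; auto.
by move=> _ /esym.
Qed.

(** * Squares and finite sequences over infinite sets *)

(** The map [p.2] is total, but constrained only on the square of [p.1]. The two distinct points
    later serve as tags. *)
Definition square_embedding (T : Type) (A : set T) (p : set T * (T * T -> T)) :=
  [/\ p.1 `<=` A, exists t0 t1, [/\ p.1 t0, p.1 t1 & t0 <> t1],
    forall u, (p.1 `*` p.1) u -> p.1 (p.2 u) &
    forall u v, (p.1 `*` p.1) u -> (p.1 `*` p.1) v -> p.2 u = p.2 v -> u = v].

(** Zorn's lemma for extension of embeddings, starting from a copy of the natural numbers in [A]. *)
Lemma ex_maximal_square_embedding (T : Type) (A : set T) :
  infinite_set A -> exists2 p, square_embedding A p &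
  forall q, square_embedding A q -> p.1 `<=` q.1 ->
    (forall u, (p.1 `*` p.1) u -> q.2 u = p.2 u) -> q.1 `<=` p.1.
Proof.
move=> Ainf; pose P := {p | square_embedding A p}.
have [p0 p0P] : exists p, square_embedding A p.
  have A0 := infinite_setN0 Ainf; have /infiniteP natA := Ainf.
  have [f [fA finj]] := card_le_injE natA A0.
  pose X := range f.
  have XN : X #= [set: nat].
    by apply: inj_card_eq => m n _ _; exact: finj.
  have XX : X `*` X #<= X.
    have Xc : countable X by rewrite /countable (card_le_eql XN) card_lexx.
    by rewrite (card_le_eqr XN); exact: countableX.
  have [|g [gX ginj]] := card_le_injE XX; first by exists (f 0%N), 0%N.
  exists (X, g); split=> //=; first by move=> _ [n _ <-]; exact: fA.
  exists (f 0%N), (f 1%N); split; [by exists 0%N|by exists 1%N|].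
  by move/finj => /(_ I I).
(* Maps that agree on a square may differ off it, so extension is only a preorder. *)
pose R (p q : P) := `[< (sval p).1 `<=` (sval q).1 /\
  forall u, ((sval p).1 `*` (sval p).1) u -> (sval q).2 u = (sval p).2 u >].
have [//| | |[p pP] pmax] := @ZL_preorder P (exist _ p0 p0P) R.
- by move=> p; apply/asboolP; split.
- move=> q p r /asboolP[pq epq] /asboolP[qr eqr]; apply/asboolP; split.
    exact: subset_trans qr.
  by move=> u [u1 u2]; rewrite eqr ?epq//; split; exact: pq.
- move=> C tot; have [[c0 Cc0]|C0] := pselect (C !=set0); last first.
    by exists (exist _ p0 p0P) => s Cs; exfalso; apply: C0; exists s.
  pose X := \bigcup_(p in C) (sval p).1.
  have join p q : C p -> C q -> exists2 r, C r & R p r /\ R q r.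
    move=> Cp Cq; have [pq|qp] := tot _ _ Cp Cq; [exists q|exists p] => //;
    by split=> //; apply/asboolP; split.
  (* Members of a chain agree wherever both are constrained, so their values glue. *)
  have [phi phiP] : exists phi, forall u p, C p ->
      ((sval p).1 `*` (sval p).1) u -> phi u = (sval p).2 u.
    suff: forall u, exists z, forall p, C p ->
      ((sval p).1 `*` (sval p).1) u -> z = (sval p).2 u.
      by move=> /choice[f fP]; exists f => u; exact: fP.
    move=> u; have [[p [Cp pu]]|nop] :=
      pselect (exists p, C p /\ ((sval p).1 `*` (sval p).1) u); last first.
      by exists u.1 => p Cp pu; exfalso; apply: nop; exists p.
    exists ((sval p).2 u) => q Cq qu.
    have [r _ [/asboolP[_ <-//] /asboolP[_ <-//]]] := join _ _ Cp Cq.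
  have inC u : (X `*` X) u -> exists2 p, C p & ((sval p).1 `*` (sval p).1) u.
    move=> [[p Cp pu] [q Cq qu]].
    have [r Cr [/asboolP[pr _] /asboolP[qr _]]] := join _ _ Cp Cq.
    by exists r => //; split; [exact: pr|exact: qr].
  have XP : square_embedding A (X, phi).
    split=> /=.
    - by move=> x [p Cp px]; have [pA _ _ _] := svalP p; exact: pA.
    - have [_ [t0 [t1 [? ? ?]]] _ _] := svalP c0.
      by exists t0, t1; split=> //; exists c0.
    - move=> u /inC[p Cp pu]; rewrite (phiP _ _ Cp pu); exists p => //.
      by have [_ _ + _] := svalP p; apply.
    - move=> u v /inC[p Cp pu] /inC[q Cq qv].
      have [r Cr [/asboolP[pr _] /asboolP[qr _]]] := join _ _ Cp Cq.
      have ru : ((sval r).1 `*` (sval r).1) u by case: pu; split; apply: pr.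
      have rv : ((sval r).1 `*` (sval r).1) v by case: qv; split; apply: qr.
      rewrite (phiP _ _ Cr ru) (phiP _ _ Cr rv).
      by have [_ _ _] := svalP r; apply.
  exists (exist _ _ XP) => p Cp; apply/asboolP; split=> /=.
    by move=> x px; exists p.
  by move=> u pu; exact: phiP.
exists p => // q qP pq epq.
have : R (exist _ p pP) (exist _ q qP) by apply/asboolP.
by move/pmax => /asboolP[].
Qed.

(* A maximal [X] with [X * X] embedded in [X] absorbs [A \ X]: otherwise
   [A \ X] contains a copy of [X], to which the embedding extends. *)
Lemma card_square_le (T : Type) (A : set T) :
  infinite_set A -> A `*` A #<= A.
Proof.
move=> /ex_maximal_square_embedding[[X phi] [/= XA X2 phiX phiI] pmax].
have XX : X `*` X #<= X by exact: (card_le_inj phiX).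
have AX : A = X `|` (A `\` X) by apply/esym/setDUK.
suff leAX : A #<= X.
  apply: card_le_trans (card_leX leAX leAX) _.
  exact: card_le_trans XX (subset_card_le XA).
have [DX|XD] := card_le_total (A `\` X) X.
  by rewrite AX; apply: card_setU_le_square.
exfalso; have [t0 [t1 [Xt0 Xt1 t01]]] := X2.
have D0 : (A `\` X) !=set0.
  apply: contrapT => D0; move: XD.
  have -> : A `\` X = set0.
    by apply/seteqP; split=> // x Dx; apply: D0; exists x.
  by rewrite card_le0 => /eqP X0; rewrite X0 in Xt0.
have [e [eD einj]] := card_le_injE XD D0.
pose Y := e @` X.
have YX : Y #<= X by exact: card_image_le.
have XYX : X `|` Y #<= X by apply: card_setU_le_square => //; exact: card_lexx.
have [|c [cX cinj]] := card_le_injE XYX; first by exists t0.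
have nXY x : X x -> Y x -> False.
  by move=> Xx [y Xy yx]; have [_] := eD y Xy; rewrite yx.
(* On new pairs, [c] moves both coordinates into [X], [phi] pairs them there, and [e] sends the
   result to [Y], away from the old values. *)
pose psi u := if `[< (X `*` X) u >] then phi u else e (phi (c u.1, c u.2)).
have in2 u : ((X `|` Y) `*` (X `|` Y)) u -> (X `*` X) (c u.1, c u.2).
  by case=> u1 u2; split; exact: cX.
have inY u : ((X `|` Y) `*` (X `|` Y)) u -> Y (e (phi (c u.1, c u.2))).
  by move=> /in2/phiX ?; exists (phi (c u.1, c u.2)).
have : X `|` Y `<=` X.
  apply: (pmax (X `|` Y, psi)) => /=; last 2 first.
  - exact: subsetUl.
  - by move=> u Xu; rewrite /psi asboolT.
  split=> /=.
  - by rewrite subUset; split=> // _ [x Xx <-]; have [] := eD x Xx.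
  - by exists t0, t1; split=> //; left.
  - move=> u uXY; rewrite /psi.
    by case: asboolP => [/phiX|_]; [left|right; exact: inY].
  - move=> u v uXY vXY; rewrite /psi.
    case: asboolP => Xu; case: asboolP => Xv.
    + exact: phiI.
    + by move=> E; exfalso; apply: (nXY _ (phiX _ Xu)); rewrite E; exact: inY.
    + by move=> E; exfalso; apply: (nXY _ (phiX _ Xv)); rewrite -E; exact: inY.
    + move=> /(einj _ _ (phiX _ (in2 _ uXY)) (phiX _ (in2 _ vXY))).
      move=> /(phiI _ _ (in2 _ uXY) (in2 _ vXY)) [].
      case: u v uXY vXY {Xu Xv} => [u1 u2] [v1 v2] [/= ? ?] [/= ? ?].
      by move=> /cinj -> // /cinj ->.
move=> /(_ (e t0)) XY; apply: (nXY (e t0)); last by exists t0.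
by apply: XY; right; exists t0.
Qed.

Lemma infinite_set_two (T : Type) (A : set T) :
  infinite_set A -> exists t0 t1, [/\ A t0, A t1 & t0 <> t1].
Proof.
move=> Ainf; have A0 := infinite_setN0 Ainf; have /infiniteP natA := Ainf.
have [f [fA finj]] := card_le_injE natA A0.
exists (f 0%N), (f 1%N); split; [exact: fA|exact: fA|].
by move/finj => /(_ I I).
Qed.

(** A list is folded into one element by a pairing function; the tags [t0] and [t1] separate the
    empty list from the others. *)
Lemma card_seq_le (T : Type) (A : set T) :
  infinite_set A -> [set s | all (mem A) s] #<= A.
Proof.
move=> Ainf; have [t0 [t1 [At0 At1 t01]]] := infinite_set_two Ainf.
have [f [fA finj]] := card_le_injE (card_square_le Ainf) (infinite_setN0 Ainf).
have t00 : (A `*` A) (t0, t0) by [].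
pose code := foldr (fun x c => f (t1, f (x, c))) (f (t0, t0)).
have codeA s : all (mem A) s -> A (code s).
  elim: s => [_|x s IH /= /andP[/set_mem Ax /IH As]]; first exact: fA.
  by apply: (fA); split=> //=; exact: fA.
have tailA x s : A x -> all (mem A) s ->
    (A `*` A) (x, code s) /\ (A `*` A) (t1, f (x, code s)).
  move=> Ax /codeA As; split; first by split.
  by split=> //=; exact: fA.
apply: (card_le_inj codeA); elim=> [|x s IH] [|y r] //=.
- move=> _ /andP[/set_mem Ay Ar]; have [_ r2] := tailA _ _ Ay Ar.
  by move=> /(finj _ _ t00 r2)[].
- move=> /andP[/set_mem Ax As] _; have [_ s2] := tailA _ _ Ax As.
  by move=> /(finj _ _ s2 t00)[/esym].
- move=> /andP[/set_mem Ax As] /andP[/set_mem Ay Ar].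
  have [s1 s2] := tailA _ _ Ax As; have [r1 r2] := tailA _ _ Ay Ar.
  by move=> /(finj _ _ s2 r2)[] /(finj _ _ s1 r1)[] -> /(IH _ As Ar) ->.
Qed.

(** * Least elements, and small sets as bounded sets *)

Lemma wf_ex_min (d : Order.disp_t) (K : orderType d) (P : set K) :
  well_founded (fun x y : K => x < y) -> P !=set0 ->
  exists2 m, P m & forall y, P y -> m <= y.
Proof.
move=> wf [x Px]; apply: contrapT => nomin.
elim/(well_founded_ind wf): x Px => x IH Px; apply: nomin; exists x => // y Py.
by rewrite leNgt; apply/negP => /IH; exact.
Qed.

Definition bounded_above (d : Order.disp_t) (K : orderType d) (A : set K) :=
  exists x, forall y, A y -> y < x.

Section Bounded.
Context (d : Order.disp_t) (K : orderType d) (Kreg : regular_uncountable K).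
Implicit Types A B : set K.

Lemma sub_bounded_above A B : A `<=` B -> bounded_above B -> bounded_above A.
Proof. by move=> AB [x xB]; exists x => y /AB/xB. Qed.

Lemma bounded_aboveU A B :
  bounded_above A -> bounded_above B -> bounded_above (A `|` B).
Proof.
move=> [x xA] [y yB]; exists (Order.max x y) => z [/xA|/yB] zx;
by rewrite lt_max zx ?orbT.
Qed.

(** A bounded set lies in a proper initial segment, which is smaller than kappa; the converse is
    regularity. *)
Lemma bounded_aboveP A : bounded_above A <-> ~ (A #= [set: K]).
Proof.
split=> [[x xA] AK|nA]; last exact: bounded_of_small.
have [_ neq] := ru_initial Kreg x; apply: neq.
apply/card_eqPle; split; first exact: card_leT.
by rewrite -(card_le_eql AK); apply: subset_card_le => y /xA.
Qed.

Lemma countable_bounded_above A : countable A -> bounded_above A.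
Proof.
move=> cA; apply/bounded_aboveP => AK; apply: (ru_uncountable Kreg).
by rewrite /countable -(card_le_eql AK).
Qed.

Lemma bounded_above_image_card_le (T : Type) (B : set T) A (f : T -> K) :
  bounded_above A -> B #<= A -> bounded_above (f @` B).
Proof.
move=> /bounded_aboveP nA BA; apply/bounded_aboveP => fBK; apply: nA.
apply/card_eqPle; split; first exact: card_leT.
rewrite -(card_le_eql fBK).
exact: card_le_trans (card_image_le f B) BA.
Qed.

Lemma bounded_above_image A (f : K -> K) :
  bounded_above A -> bounded_above (f @` A).
Proof. by move=> bA; apply: bounded_above_image_card_le bA (card_lexx A). Qed.

Lemma bounded_above_le (x : K) : bounded_above [set y | y <= x].
Proof.
have [z xz] : bounded_above [set x].
  by apply: countable_bounded_above; exact: countable1.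
by exists z => y /le_lt_trans; apply; exact: xz.
Qed.

(** The chosen bounds form a countable set, itself bounded because kappa has uncountable
    cofinality. *)
Lemma bounded_above_bigcup_nat (E : nat -> set K) :
  (forall n, bounded_above (E n)) -> bounded_above (\bigcup_n E n).
Proof.
move=> /choice[b bE].
have [x xb] : bounded_above (range b).
  apply: countable_bounded_above; apply: card_le_trans (card_image_le b _) _.
  exact: card_lexx.
exists x => y [n _ /bE yb]; apply: lt_trans yb _; apply: xb.
by exists n.
Qed.

Lemma lt_starP (f g : K -> K) :
  lt_star f g <-> bounded_above [set x | g x <= f x].
Proof.
rewrite bounded_aboveP; split=> [[]//|nE]; split=> //; exact: card_leT.
Qed.

(** A family injected into kappa by [i] is dominated diagonally: at [x] only the functions with
    [i f <= x] must be exceeded, and their values at [x] are bounded. *)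
Lemma card_le_unbounded_family (F : set (K -> K)) :
  unbounded_family F -> [set: K] #<= F.
Proof.
move=> unbF; have [//|FK] := card_le_total [set: K] F; exfalso; apply: unbF.
have [x0 _] : [set: K] !=set0.
  by apply: infinite_setN0 => /finite_set_countable; exact: ru_uncountable.
have [i [_ iinj]] := card_le_injE FK (ex_intro _ x0 I).
have /choice[g gP] : forall x, exists y, forall f, F f -> i f <= x -> f x < y.
  move=> x; pose B := [set f | F f /\ i f <= x].
  have [|z zB] :=
    @bounded_above_image_card_le _ B _ (fun f => f x) (bounded_above_le x).
    apply: (@card_le_inj _ _ _ _ i) => [f []//|f h [Ff _] [Fh _]]; exact: iinj.
  by exists z => f Ff ix; apply: zB; exists f.
exists g => f Ff; apply/lt_starP; exists (i f) => x /= gf.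
by rewrite ltNge; apply/negP => ix; move: (gP x f Ff ix); rewrite ltNge gf.
Qed.

Lemma unsplit_bounded (A a : set K) :
  ~ splits a A -> bounded_above (A `&` a) \/ bounded_above (A `\` a).
Proof.
by rewrite !bounded_aboveP -not_andP; exact.
Qed.

(** * Dominating a family by means of an unsplit set *)

Section Domination.
Context (G : (K -> K) -> K -> K).
Context (GP : forall h y, y <= Order.max (G h y) (h (G h y))).
Context (Gmin : forall h y x, y <= Order.max x (h x) -> G h y <= x).

Context (F : set (K -> K)) (A : set K).
Context (Aunb : ~ bounded_above A).
Context (unsplit_le : forall s x, all (mem F) s ->
  ~ splits [set y | foldr G y s <= x] A).
Context (unsplit_lt : forall h s, all (mem F) (h :: s) ->
  ~ splits [set y | G h (foldr G y s) < foldr G y s] A).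

(** Convergence to kappa along [A] of the composition coded by [s], whose head is applied last. *)
Let tends s := forall x, bounded_above (A `&` [set y | foldr G y s <= x]).

(* Otherwise dependent choice gives a sequence of functions that decreases at
   some point of [A], since [kappa] has uncountable cofinality. *)
Lemma ex_minimal_foldr : exists s, [/\ all (mem F) s, tends s &
  forall h, F h -> tends (h :: s) ->
    ~ bounded_above (A `\` [set y | G h (foldr G y s) < foldr G y s])].
Proof.
apply: contrapT => nos.
pose ok s := all (mem F) s /\ tends s.
have next s : exists h, ok s -> ok (h :: s) /\
    bounded_above (A `\` [set y | G h (foldr G y s) < foldr G y s]).
  apply: contrapT => noh; apply: nos; exists s.
  have [[Fs ts]|nok] := pselect (ok s); last by exfalso; apply: noh; exists id.
  split=> // h Fh ths bh; apply: noh; exists h => _; split=> //; split=> //=.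
  by rewrite Fs andbT; exact: mem_set.
have [n nP] := choice next.
pose t k := iter k (fun s => n s :: s) [::].
have tok k : ok (t k).
  elim: k => [|k /nP[]//]; split=> // x /=.
  by apply: sub_bounded_above (bounded_above_le x); apply: subIsetr.
(* The exceptional sets of all steps have a common bound [z], so every step decreases strictly at a
   point [y] of [A] not below [z]. *)
have [z zP] : bounded_above (\bigcup_k
    (A `\` [set y | foldr G y (t k.+1) < foldr G y (t k)])).
  by apply: bounded_above_bigcup_nat => k; have [] := nP _ (tok k).
have [y Ay zy] : exists2 y, A y & z <= y.
  apply: contrapT => noy; apply: Aunb; exists z => y Ay.
  by rewrite ltNge; apply/negP => zy; apply: noy; exists y.
have dec k : foldr G y (t k.+1) < foldr G y (t k).
  apply: contrapT => nlt; have : y < z by apply: zP; exists k.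
  by rewrite ltNge zy.
have [|_ [k _ <-] kmin] :=
  @wf_ex_min _ _ (range (fun k => foldr G y (t k))) (ru_wf Kreg).
  by exists (foldr G y (t 0%N)), 0%N.
have : foldr G y (t k) <= foldr G y (t k.+1) by apply: kmin; exists k.+1.
by rewrite leNgt dec.
Qed.

Lemma unsplit_dominated : exists g, forall h, F h -> lt_star h g.
Proof.
have [s [Fs ts smin]] := ex_minimal_foldr.
pose f y := foldr G y s.
have Fhs h : F h -> all (mem F) (h :: s).
  by move=> Fh /=; rewrite Fs andbT; exact: mem_set.
have stable h : F h -> bounded_above (A `&` [set y | G h (f y) < f y]).
  move=> Fh; have [//|bh] := unsplit_bounded (unsplit_lt (Fhs h Fh)).
  have : ~ tends (h :: s) by move=> /(smin h Fh); apply.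
  move=> /existsNP[x nx].
  have [//|bx] := unsplit_bounded (unsplit_le (x := x) (Fhs h Fh)).
  (* A point [y] of [A] outside the three bounded sets below would satisfy [G h (f y) <= x], hence
     [f y <= h (G h (f y)) < z <= w < f y]. *)
  have [z zP] := bounded_above_image h (bounded_above_le x).
  exfalso; apply: Aunb; pose w := Order.max x z.
  apply: sub_bounded_above
    (bounded_aboveU (ts w) (bounded_aboveU bh bx)) => y Ay.
  have [yw|yw] := leP (f y) w; first by left; split.
  right; have [Gy|Gy] := pselect (G h (f y) < f y); last by left; split.
  right; split=> //= Gx.
  have := GP h (f y); rewrite le_max leNgt Gy /= leNgt => /negP; apply.
  apply: lt_trans yw; rewrite /w lt_max; apply/orP; right.
  by apply: zP; exists (G h (f y)).
have /choice[a aP] : forall x, exists y, [/\ A y, x <= y & x < f y].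
  move=> x; apply: contrapT => noy; apply: Aunb.
  apply: sub_bounded_above (bounded_aboveU (bounded_above_le x) (ts x)) => y Ay.
  have [yx|xy] := leP y x; first by left.
  right; split=> //=; rewrite leNgt; apply/negP => xfy.
  by apply: noy; exists y; split=> //; exact: ltW.
exists (f \o a) => h Fh; apply/lt_starP.
have [z zP] := stable h Fh.
(* From [f (a x) <= h x], [Gmin] gives [G h (f (a x)) <= x < f (a x)]; so [a x] lies in the set
   bounded by [z], and [x <= a x < z]. *)
exists z => x /= fh; have [Aa xa xf] := aP x.
apply: le_lt_trans xa _; apply: zP; split=> //=.
apply: le_lt_trans xf; apply: Gmin.
by rewrite le_max fh orbT.
Qed.

End Domination.

End Bounded.

(** * Building and counting a splitting family *)

Theorem theorem1p10 (d : Order.disp_t) (K : orderType d)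
    (hK : regular_uncountable K) :
  splitting_number K #<= bounding_number K.
Proof.
have [unbF _] := bounding_numberP K; set F := bounding_number K in unbF *.
have KF := card_le_unbounded_family hK unbF.
have Finf : infinite_set F.
  move=> /(card_le_finite KF) /finite_set_countable; exact: ru_uncountable.
have /choice[G GP] : forall h : K -> K, exists g : K -> K, forall y,
    y <= Order.max (g y) (h (g y)) /\
    forall x, y <= Order.max x (h x) -> g y <= x.
  move=> h; suff /choice[g gP] : forall y, exists z,
      y <= Order.max z (h z) /\ forall x, y <= Order.max x (h x) -> z <= x.
    by exists g.
  move=> y.
  have [|m] := @wf_ex_min _ _ [set x | y <= Order.max x (h x)] (ru_wf hK).
    by exists y; rewrite /= le_max lexx.
  by exists m.
(* The head of the list is tested against the composition of its tail; the empty list gets all of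
   [K] as default. *)
pose lt_set s : set K :=
  [set y | if s is h :: r then G h (foldr G y r) < foldr G y r else true].
pose le_set (p : seq (K -> K) * K) : set K := [set y | foldr G y p.1 <= p.2].
pose seqF := [set s | all (mem F) s].
pose S := (lt_set @` seqF) `|` (le_set @` (seqF `*` [set: K])).
(* Lists over [F] are no more numerous than [F], and the constants in [K] are absorbed since kappa
   is at most the size of [F]. *)
have SF : S #<= F.
  have seqFF : seqF #<= F by exact: card_seq_le.
  have FF := card_square_le Finf.
  apply: card_setU_le_square => //; last exact: infinite_set_two.
    by apply: card_le_trans seqFF; exact: card_image_le.
  apply: card_le_trans (card_image_le _ _) _.
  exact: card_le_trans (card_leX seqFF KF) FF.
have [_ smin] := splitting_numberP hK.
apply: card_le_trans SF; apply: smin => A AK.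
apply: contrapT => nsp; apply: unbF.
have nspS a : S a -> ~ splits a A by move=> Sa spa; apply: nsp; exists a.
apply: (@unsplit_dominated _ _ hK G _ _ F A).
- by move=> h y; have [] := GP h y.
- by move=> h y; have [_] := GP h y.
- by move/(bounded_aboveP hK); apply.
- by move=> s x Fs; apply: nspS; right; exists (s, x).
- by move=> h s Fs; apply: nspS; left; exists (h :: s).
Qed.
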